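(* Let $\mathbb{K}\in\{\mathbb{R},\mathbb{C}\}$, let $\boldsymbol{\sigma}=(\sigma_1,\dots,\sigma_N)$ be positive integers, and let $\mathbf{B}_i\in\mathbb{K}^{m\times n_i}$, $i=1,\dots,N$, be a pairwise $(\delta^*_{2\sigma},\boldsymbol{\sigma})$-incoherent family for a number $\delta^*_{2\sigma}>0$. Assume further that $\sup_i\delta_{\sigma_i}(\mathbf{B}_i)\le\delta^*_\sigma$ for a number $\delta^*_\sigma$. Let $\mathbf{A}\in\mathbb{K}^{M\times N}$ have columns $\mathbf{a}_1,\dots,\mathbf{a}_N$ and satisfy $\delta_{2s}(\mathbf{A})<1$ for some positive integer $s$, and let $\mathbf{H}:\bigoplus_{i=1}^N\mathbb{K}^{n_i}\to\mathbb{K}^M\otimes\mathbb{K}^m$ be the hierarchical measurement operator $$\mathbf{H}(\mathbf{x}_1,\dots,\mathbf{x}_N)=\sum_{i=1}^N\mathbf{a}_i\otimes(\mathbf{B}_i\mathbf{x}_i).$$ Then for every positive integer $\lambda$, $\mathbf{H}$ has the $(\lambda s,\boldsymbol{\sigma})$-HiRIP with $$\delta_{(\lambda s,\boldsymbol{\sigma})}(\mathbf{H})\le\delta_s(\mathbf{A})+\delta^*_\sigma+\delta_s(\mathbf{A})\,\delta^*_\sigma+\lambda\sqrt{s}\,\delta_{2s}(\mathbf{A})\,\delta^*_{2\sigma}.$$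
   Context: All vector norms $\|\cdot\|$ are Euclidean; $\mathbb{K}^M\otimes\mathbb{K}^m\cong\mathbb{K}^{Mm}$ carries the Euclidean norm. A vector is $s$-sparse if it has at most $s$ nonzero entries. A block vector $\mathbf{x}=(\mathbf{x}_1,\dots,\mathbf{x}_N)\in\mathbb{K}^{n_1}\times\dots\times\mathbb{K}^{n_N}$ is $(s,\boldsymbol{\sigma})$-sparse if at most $s$ of the blocks $\mathbf{x}_i$ are nonzero and each nonzero block $\mathbf{x}_i$ is $\sigma_i$-sparse. For a matrix $\mathbf{C}$, $\delta_s(\mathbf{C})$ (the $s$-RIP constant) is the smallest $\delta\ge0$ with $(1-\delta)\|\mathbf{x}\|^2\le\|\mathbf{C}\mathbf{x}\|^2\le(1+\delta)\|\mathbf{x}\|^2$ for all $s$-sparse $\mathbf{x}$; $\delta_{(s,\boldsymbol{\sigma})}(\mathbf{H})$ (the $(s,\boldsymbol{\sigma})$-HiRIP constant) is defined in the same way with all $(s,\boldsymbol{\sigma})$-sparse $\mathbf{x}$. The family $(\mathbf{B}_i)_{i\in[N]}$ is pairwise $(\delta,\boldsymbol{\sigma})$-incoherent if for all $i\ne j$ and all normalized (unit-norm) vectors $\mathbf{v}_i\in\mathbb{K}^{n_i}$, $\mathbf{v}_j\in\mathbb{K}^{n_j}$ that are $\sigma_i$-sparse and $\sigma_j$-sparse respectively, $|\langle\mathbf{B}_i\mathbf{v}_i,\mathbf{B}_j\mathbf{v}_j\rangle|\le\delta$. The symbols $\delta^*_\sigma$ and $\delta^*_{2\sigma}$ are just names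 of real numbers. *)

(* Defs.v *)
From HB Require Import structures.
From mathcomp Require Import all_boot all_order all_algebra.
From mathcomp Require Import all_classical all_reals.
From mathcomp Require Import complex mxtens.

Set Implicit Arguments.
Unset Strict Implicit.
Unset Printing Implicit Defensive.

Import Order.TTheory GRing.Theory Num.Theory.

Local Open Scope classical_set_scope.
Local Open Scope ring_scope.

Inductive scalar_kind := RealScalars | ComplexScalars.

Definition scalar_field (R : realType) (k : scalar_kind) : numFieldType :=
  match k with
  | RealScalars => R
  | ComplexScalars => R[i]
  end.

(* The modulus has values in [R]; the norm of [R[i]] as a [numFieldType]
   has values in [R[i]] itself. *)
Definition modulus (R : realType) (k : scalar_kind) : scalar_field R k -> R :=
  match k with
  | RealScalars => fun x : R => `|x|
  | ComplexScalars => fun z : R[i] => ComplexField.Normc.normc z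
  end.

Definition sconj (R : realType) (k : scalar_kind) :
    scalar_field R k -> scalar_field R k :=
  match k with
  | RealScalars => fun x : R => x
  | ComplexScalars => fun z : R[i] => conjc z
  end.

Definition inner (R : realType) (k : scalar_kind) (p : nat)
    (u v : 'cV[scalar_field R k]_p) : scalar_field R k :=
  \sum_(j < p) sconj (u j 0) * v j 0.

Definition enorm (R : realType) (k : scalar_kind) (p : nat)
    (x : 'cV[scalar_field R k]_p) : R :=
  Num.sqrt (\sum_(j < p) modulus (x j 0) ^+ 2).

Definition supp (R : realType) (k : scalar_kind) (p : nat)
    (x : 'cV[scalar_field R k]_p) : {set 'I_p} :=
  [set j | x j 0 != 0]%SET.

Definition sparse (R : realType) (k : scalar_kind) (p : nat) (s : nat)
    (x : 'cV[scalar_field R k]_p) : Prop :=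
  (#|supp x| <= s)%N.

Definition rip (R : realType) (k : scalar_kind) (q p : nat)
    (C : 'M[scalar_field R k]_(q, p)) (s : nat) (d : R) : Prop :=
  0 <= d /\
  forall x : 'cV[scalar_field R k]_p, sparse s x ->
    (1 - d) * enorm x ^+ 2 <= enorm (C *m x) ^+ 2
                           <= (1 + d) * enorm x ^+ 2.

(* This infimum is a minimum, see [rip_const_min] below. *)
Definition rip_const (R : realType) (k : scalar_kind) (q p : nat)
    (C : 'M[scalar_field R k]_(q, p)) (s : nat) : R :=
  inf [set d | rip C s d].

Definition block_vector (R : realType) (k : scalar_kind) (N : nat)
    (n : 'I_N -> nat) : Type :=
  forall i : 'I_N, 'cV[scalar_field R k]_(n i).

Definition block_enorm (R : realType) (k : scalar_kind) (N : nat)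
    (n : 'I_N -> nat) (x : block_vector R k n) : R :=
  Num.sqrt (\sum_(i < N) enorm (x i) ^+ 2).

Definition block_supp (R : realType) (k : scalar_kind) (N : nat)
    (n : 'I_N -> nat) (x : block_vector R k n) : {set 'I_N} :=
  [set i | x i != 0]%SET.

Definition block_sparse (R : realType) (k : scalar_kind) (N : nat)
    (n : 'I_N -> nat) (s : nat) (sigma : 'I_N -> nat)
    (x : block_vector R k n) : Prop :=
  (#|block_supp x| <= s)%N /\
  forall i : 'I_N, x i != 0 -> sparse (sigma i) (x i).

Definition hirip (R : realType) (k : scalar_kind) (q N : nat)
    (n : 'I_N -> nat) (H : block_vector R k n -> 'cV[scalar_field R k]_q)
    (s : nat) (sigma : 'I_N -> nat) (d : R) : Prop :=
  0 <= d /\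
  forall x : block_vector R k n, block_sparse s sigma x ->
    (1 - d) * block_enorm x ^+ 2 <= enorm (H x) ^+ 2
                                 <= (1 + d) * block_enorm x ^+ 2.

(* For [H] a hierarchical measurement operator this infimum is a minimum,
   see [hirip_const_min] below. *)
Definition hirip_const (R : realType) (k : scalar_kind) (q N : nat)
    (n : 'I_N -> nat) (H : block_vector R k n -> 'cV[scalar_field R k]_q)
    (s : nat) (sigma : 'I_N -> nat) : R :=
  inf [set d | hirip H s sigma d].

Definition pairwise_incoherent (R : realType) (k : scalar_kind) (m N : nat)
    (n : 'I_N -> nat) (B : forall i : 'I_N, 'M[scalar_field R k]_(m, n i))
    (delta : R) (sigma : 'I_N -> nat) : Prop :=
  forall i j : 'I_N, i != j ->
  forall (u : 'cV[scalar_field R k]_(n i)) (v : 'cV[scalar_field R k]_(n j)),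
    enorm u = 1 -> enorm v = 1 ->
    sparse (sigma i) u -> sparse (sigma j) v ->
    modulus (inner (B i *m u) (B j *m v)) <= delta.

(* [*t] is the Kronecker product; the product of two columns has type
   ['M_(M * m, 1 * 1)], which is convertible to ['cV_(M * m)]. *)
Definition hierarchical_operator (R : realType) (k : scalar_kind)
    (M m N : nat) (n : 'I_N -> nat) (A : 'M[scalar_field R k]_(M, N))
    (B : forall i : 'I_N, 'M[scalar_field R k]_(m, n i))
    (x : block_vector R k n) : 'cV[scalar_field R k]_(M * m) :=
  \sum_(i < N) (col i A *t (B i *m x i) : 'cV[scalar_field R k]_(M * m)).

Lemma modulus_ge0 (R : realType) (k : scalar_kind) (z : scalar_field R k) :
  0 <= modulus z.
Proof. by case: k z => [z|[a b]] /=; rewrite ?normr_ge0 ?sqrtr_ge0. Qed.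

Lemma modulus0 (R : realType) (k : scalar_kind) :
  modulus (0 : scalar_field R k) = 0.
Proof. by case: k; [exact: normr0 | exact: ComplexField.Normc.normc0]. Qed.

Lemma modulusM (R : realType) (k : scalar_kind) (y z : scalar_field R k) :
  modulus (y * z) = modulus y * modulus z.
Proof.
by case: k y z => y z; [exact: normrM|exact: ComplexField.Normc.normcM].
Qed.

Lemma le_modulusD (R : realType) (k : scalar_kind) (y z : scalar_field R k) :
  modulus (y + z) <= modulus y + modulus z.
Proof.
case: k y z => [y z|y z]; first exact: ler_normD.
have := ler_normD (y : R[i]) z; rewrite !normc_def -rmorphD lecR.
by case: y z => ? ? [].
Qed.

Lemma le_modulus_sum (R : realType) (k : scalar_kind) (p : nat)
    (F : 'I_p -> scalar_field R k) :
  modulus (\sum_(j < p) F j) <= \sum_(j < p) modulus (F j).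
Proof.
apply: (big_ind2 (fun y r => modulus y <= r)) => [|y r y' r' yr yr'|//].
  by rewrite modulus0.
by rewrite (le_trans (le_modulusD _ _))// lerD.
Qed.

Lemma enorm_ge0 (R : realType) (k : scalar_kind) (p : nat)
    (x : 'cV[scalar_field R k]_p) : 0 <= enorm x.
Proof. exact: sqrtr_ge0. Qed.

Lemma enorm_sqr (R : realType) (k : scalar_kind) (p : nat)
    (x : 'cV[scalar_field R k]_p) :
  enorm x ^+ 2 = \sum_(j < p) modulus (x j 0) ^+ 2.
Proof. by rewrite sqr_sqrtr// sumr_ge0// => j _; exact: sqr_ge0. Qed.

Lemma block_enorm_sqr (R : realType) (k : scalar_kind) (N : nat)
    (n : 'I_N -> nat) (x : block_vector R k n) :
  block_enorm x ^+ 2 = \sum_(i < N) enorm (x i) ^+ 2.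
Proof. by rewrite sqr_sqrtr// sumr_ge0// => j _; exact: sqr_ge0. Qed.

Lemma le_modulus_enorm (R : realType) (k : scalar_kind) (p : nat)
    (x : 'cV[scalar_field R k]_p) (j : 'I_p) : modulus (x j 0) <= enorm x.
Proof.
rewrite -(@ler_pXn2r R 2) ?nnegrE ?modulus_ge0 ?enorm_ge0//.
rewrite enorm_sqr (bigD1 j)//= lerDl sumr_ge0// => i _; exact: sqr_ge0.
Qed.

Lemma le_enorm_block (R : realType) (k : scalar_kind) (N : nat)
    (n : 'I_N -> nat) (x : block_vector R k n) (i : 'I_N) :
  enorm (x i) <= block_enorm x.
Proof.
rewrite -(@ler_pXn2r R 2) ?nnegrE ?enorm_ge0 ?sqrtr_ge0//.
rewrite block_enorm_sqr (bigD1 i)//= lerDl sumr_ge0// => j _; exact: sqr_ge0.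
Qed.

Lemma enorm_le_coord (R : realType) (k : scalar_kind) (p : nat)
    (x : 'cV[scalar_field R k]_p) (c : 'I_p -> R) (r : R) :
  (forall j, modulus (x j 0) <= c j * r) ->
  enorm x ^+ 2 <= (\sum_(j < p) c j ^+ 2) * r ^+ 2.
Proof.
move=> xc; rewrite enorm_sqr mulr_suml ler_sum// => j _.
rewrite -exprMn lerXn2r ?nnegrE ?modulus_ge0//.
exact: (le_trans (modulus_ge0 _) (xc j)).
Qed.

Lemma modulus_mulmx_le (R : realType) (k : scalar_kind) (q p : nat)
    (C : 'M[scalar_field R k]_(q, p)) (x : 'cV[scalar_field R k]_p) (l : 'I_q) :
  modulus ((C *m x) l 0) <= (\sum_(j < p) modulus (C l j)) * enorm x.
Proof.
rewrite mxE (le_trans (le_modulus_sum _))// mulr_suml ler_sum// => j _.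
by rewrite modulusM ler_wpM2l ?modulus_ge0// le_modulus_enorm.
Qed.

(* The least admissible constant exists as soon as some constant is
   admissible: the constraints are closed. *)
Lemma min_defect (R : realType) (V : Type) (P : V -> Prop) (a b : V -> R)
    (c : R) (S := [set d : R | 0 <= d /\
      forall x, P x -> (1 - d) * a x <= b x <= (1 + d) * a x]) :
  (forall x, 0 <= a x) -> (forall x, 0 <= b x) ->
  (forall x, b x <= c * a x) ->
  S (inf S) /\ forall d, S d -> inf S <= d.
Proof.
move=> a0 b0 bc.
have S0 : S !=set0.
  exists (1 + `|c|); split=> [|x _]; first by rewrite addr_ge0.
  apply/andP; split.
    rewrite opprD addrA subrr add0r mulNr (le_trans _ (b0 x))//.
    by rewrite oppr_le0 mulr_ge0.
  rewrite (le_trans (bc x))// ler_wpM2r// (le_trans (ler_norm c))//.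
  by rewrite addrA lerDr addr_ge0.
have Slb : has_lbound S by exists 0 => d [].
have infle d : S d -> inf S <= d by move=> Sd; exact: ge_inf.
split=> //; split; first by apply: lb_le_inf => // d [].
move=> x Px; have [ax0|ax0] := eqVneq (a x) 0.
  by have [d [_ /(_ x Px)]] := S0; rewrite ax0 !mulr0.
have {}ax0 : 0 < a x by rewrite lt_neqAle eq_sym ax0 a0.
apply/andP; split.
  rewrite -ler_pdivlMr// lerBlDr -lerBlDl.
  apply: lb_le_inf => // d [_ /(_ x Px)].
  by case/andP=> + _; rewrite -ler_pdivlMr// lerBlDr -lerBlDl.
rewrite -ler_pdivrMr// -lerBlDl; apply: lb_le_inf => // d [_ /(_ x Px)].
by case/andP=> _; rewrite -ler_pdivrMr// -lerBlDl.
Qed.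

Lemma rip_const_min (R : realType) (k : scalar_kind) (q p : nat)
    (C : 'M[scalar_field R k]_(q, p)) (s : nat) :
  rip C s (rip_const C s) /\ forall d, rip C s d -> rip_const C s <= d.
Proof.
apply: (@min_defect R _ (fun x => sparse s x) (fun x => enorm x ^+ 2)
  (fun x => enorm (C *m x) ^+ 2)
  (\sum_(l < q) (\sum_(j < p) modulus (C l j)) ^+ 2)) => x; rewrite ?sqr_ge0//.
by apply: enorm_le_coord => l; exact: modulus_mulmx_le.
Qed.

Lemma hirip_const_min (R : realType) (k : scalar_kind) (M m N : nat)
    (n : 'I_N -> nat) (A : 'M[scalar_field R k]_(M, N))
    (B : forall i : 'I_N, 'M[scalar_field R k]_(m, n i))
    (s : nat) (sigma : 'I_N -> nat)
    (H := hierarchical_operator A B) :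
  hirip H s sigma (hirip_const H s sigma) /\
  forall d, hirip H s sigma d -> hirip_const H s sigma <= d.
Proof.
pose c (l : 'I_(M * m)) : R := \sum_(i < N)
  modulus (A (mxtens_unindex l).1 i) *
  \sum_(j < n i) modulus (B i (mxtens_unindex l).2 j).
apply: (@min_defect R _ (fun x : block_vector R k n => block_sparse s sigma x)
  (fun x => block_enorm x ^+ 2) (fun x => enorm (H x) ^+ 2)
  (\sum_l c l ^+ 2)) => x; rewrite ?sqr_ge0//.
apply: enorm_le_coord => l.
rewrite /H /hierarchical_operator summxE (le_trans (le_modulus_sum _))//.
rewrite mulr_suml ler_sum// => i _.
rewrite mxE modulusM mxE -mulrA ler_wpM2l ?modulus_ge0// !ord1.
rewrite (le_trans (modulus_mulmx_le _ _ _))// ler_wpM2l ?le_enorm_block//.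
by apply: sumr_ge0 => j _; exact: modulus_ge0.
Qed.

(* Main.v *)
Require Import Defs.
From HB Require Import structures.
From mathcomp Require Import all_boot all_order all_algebra.
From mathcomp Require Import all_classical all_reals.
From mathcomp Require Import complex mxtens ring lra zify.

Set Implicit Arguments.
Unset Strict Implicit.
Unset Printing Implicit Defensive.

Import Order.TTheory GRing.Theory Num.Theory.
Local Open Scope classical_set_scope.
Local Open Scope ring_scope.

(** Expand [|H x|^2] as the double sum of [<a_i, a_j> <B_i x_i, B_j x_j>].
    The diagonal is controlled by the column norms of [A] and the RIP of the
    [B_i]. Off the diagonal, incoherence reduces the claim to a bound on the
    quadratic form [|<a_i, a_j>|], [i != j], restricted to at most [lambda s]
    indices. Any row of the Gram matrix restricted to [s] off-diagonal entries
    has square sum at most [delta_2s(A)^2], so the Hilbert-Schmidt norm of the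
    restriction is at most [lambda sqrt(s) delta_2s(A)]. *)

(** * Scalars: conjugation, real part and modulus, uniformly in the field *)

Definition real_part (R : realType) (k : scalar_kind) : scalar_field R k -> R :=
  match k with
  | RealScalars => fun x : R => x
  | ComplexScalars => fun z : R[i] => complex.Re z
  end.

Definition real_scalar (R : realType) (k : scalar_kind) :
    R -> scalar_field R k :=
  match k with
  | RealScalars => fun x : R => x
  | ComplexScalars => fun x : R => x%:C%C
  end.

Section Scalars.
Context (R : realType) (k : scalar_kind).
Local Notation K := (scalar_field R k).
Implicit Types (y z : K) (t : R).

Lemma sconj_is_zmod_morphism : zmod_morphism (@sconj R k).
Proof. by case: k => // y z; rewrite /sconj rmorphB. Qed.

Lemma sconj_is_monoid_morphism : monoid_morphism (@sconj R k).
Proof.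
by case: k; split=> //; [exact: (rmorph1 (@conjc R))|exact: (rmorphM (@conjc R))].
Qed.

Lemma real_part_is_zmod_morphism : zmod_morphism (@real_part R k).
Proof. by case: k => // -[a b] [c d]. Qed.

HB.instance Definition _ :=
  GRing.isZmodMorphism.Build K K (@sconj R k) sconj_is_zmod_morphism.
HB.instance Definition _ :=
  GRing.isMonoidMorphism.Build K K (@sconj R k) sconj_is_monoid_morphism.
HB.instance Definition _ :=
  GRing.isZmodMorphism.Build K R (@real_part R k) real_part_is_zmod_morphism.

Lemma modulus_sconj z : modulus (sconj z) = modulus z.
Proof. by case: k z => // -[a b]; rewrite /= sqrrN. Qed.

Lemma modulus_real_scalar t : modulus (real_scalar k t) = `|t|.
Proof. by case: k => //=; rewrite expr0n addr0 sqrtr_sqr. Qed.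

Lemma modulus_sqr z : modulus z ^+ 2 = real_part (sconj z * z).
Proof.
case: k z => [z|[a b]] /=; first by rewrite real_normK ?num_real// expr2.
by rewrite sqr_sqrtr ?addr_ge0 ?sqr_ge0// mulNr opprK -!expr2.
Qed.

Lemma real_part_le_modulus z : `|real_part z| <= modulus z.
Proof.
case: k z => [z|[a b]] //=.
by rewrite -[leLHS]sqrtr_sqr ler_wsqrtr// lerDl sqr_ge0.
Qed.

(** Restricting [t] to real values makes this a real quadratic polynomial in [t] over both fields,
    which can later be optimised. *)
Lemma modulus_sqrD t y z :
  modulus (y + real_scalar k t * z) ^+ 2 =
  modulus y ^+ 2 + t * real_part (sconj y * z) *+ 2
  + t ^+ 2 * modulus z ^+ 2.
Proof.
rewrite !modulus_sqr; case: k y z => [y z|[a b] [c d]] /=.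
  by rewrite /sconj; ring.
by ring.
Qed.

End Scalars.

(** * Inner products and Euclidean norms, including Kronecker products *)

Section Inner.
Context (R : realType) (k : scalar_kind).
Local Notation K := (scalar_field R k).

Lemma inner_suml p (I : Type) (r : seq I) (P : pred I) (u : I -> 'cV[K]_p)
    (v : 'cV[K]_p) :
  inner (\sum_(i <- r | P i) u i) v = \sum_(i <- r | P i) inner (u i) v.
Proof.
rewrite /inner [RHS]exchange_big/=; apply: eq_bigr => j _.
by rewrite summxE rmorph_sum mulr_suml.
Qed.

Lemma inner_sumr p (I : Type) (r : seq I) (P : pred I) (u : 'cV[K]_p)
    (v : I -> 'cV[K]_p) :
  inner u (\sum_(i <- r | P i) v i) = \sum_(i <- r | P i) inner u (v i).
Proof.
rewrite /inner [RHS]exchange_big/=; apply: eq_bigr => j _.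
by rewrite summxE mulr_sumr.
Qed.

Lemma innerZl p (c : K) (u v : 'cV[K]_p) :
  inner (c *: u) v = sconj c * inner u v.
Proof.
by rewrite /inner mulr_sumr; apply: eq_bigr => j _; rewrite mxE rmorphM mulrA.
Qed.

Lemma innerZr p (c : K) (u v : 'cV[K]_p) : inner u (c *: v) = c * inner u v.
Proof.
by rewrite /inner mulr_sumr; apply: eq_bigr => j _; rewrite mxE mulrCA.
Qed.

(** Reindexing the coordinates of the Kronecker product by pairs turns the sum into a product of two
    sums. *)
Lemma inner_tens p q (a b : 'cV[K]_p) (u v : 'cV[K]_q) :
  @inner R k (p * q) (a *t u) (b *t v) = inner a b * inner u v.
Proof.
rewrite /inner big_distrl/=.
rewrite (eq_bigr (fun i => \sum_(j < q)
  (sconj (a i 0) * b i 0) * (sconj (u j 0) * v j 0))); last first.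
  by move=> i _; rewrite mulr_sumr.
rewrite pair_big/= (reindex (@mxtens_index p q))/=; last first.
  exists (@mxtens_unindex p q) => i _;
    [exact: mxtens_indexK|exact: mxtens_unindexK].
apply: eq_bigr => -[i j] _; rewrite !mxE !mxtens_indexK !ord1/= rmorphM.
by rewrite mulrACA.
Qed.

Lemma inner0l p (v : 'cV[K]_p) : inner 0 v = 0.
Proof. by rewrite -(scale0r (0 : 'cV[K]_p)) innerZl rmorph0 mul0r. Qed.

Lemma inner0r p (u : 'cV[K]_p) : inner u 0 = 0.
Proof. by rewrite -(scale0r (0 : 'cV[K]_p)) innerZr mul0r. Qed.

Lemma enorm_sqr_inner p (x : 'cV[K]_p) :
  enorm x ^+ 2 = real_part (inner x x).
Proof.
by rewrite enorm_sqr raddf_sum; apply: eq_bigr => j _; rewrite modulus_sqr.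
Qed.

(** The off-diagonal sum runs over ordered pairs, hence no factor 2. *)
Lemma enorm_sqr_sum p N (w : 'I_N -> 'cV[K]_p) :
  enorm (\sum_i w i) ^+ 2 =
  \sum_i enorm (w i) ^+ 2
  + \sum_i \sum_(j | j != i) real_part (inner (w i) (w j)).
Proof.
rewrite enorm_sqr_inner inner_suml raddf_sum -big_split/=.
apply: eq_bigr => i _; rewrite inner_sumr raddf_sum (bigD1 i)//=.
by rewrite enorm_sqr_inner.
Qed.

Lemma enorm_sqr_tens p q (a : 'cV[K]_p) (u : 'cV[K]_q) :
  @enorm R k (p * q) (a *t u) ^+ 2 = enorm a ^+ 2 * enorm u ^+ 2.
Proof.
rewrite !enorm_sqr big_distrl/=.
under [RHS]eq_bigr do rewrite mulr_sumr.
rewrite pair_big/= (reindex (@mxtens_index p q))/=; last first.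
  exists (@mxtens_unindex p q) => i _;
    [exact: mxtens_indexK|exact: mxtens_unindexK].
apply: eq_bigr => -[i j] _.
by rewrite !mxE !mxtens_indexK !ord1/= modulusM exprMn.
Qed.

Lemma enorm_sqrD p (t : R) (u v : 'cV[K]_p) :
  enorm (u + real_scalar k t *: v) ^+ 2 =
  enorm u ^+ 2 + t * real_part (inner u v) *+ 2 + t ^+ 2 * enorm v ^+ 2.
Proof.
rewrite !enorm_sqr /inner raddf_sum !mulr_sumr -sumrMnl -!big_split/=.
by apply: eq_bigr => j _; rewrite !mxE modulus_sqrD.
Qed.

Lemma enormZ p (c : K) (u : 'cV[K]_p) : enorm (c *: u) = modulus c * enorm u.
Proof.
apply: (@pexpIrn _ 2); rewrite ?nnegrE ?mulr_ge0 ?modulus_ge0 ?enorm_ge0//.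
rewrite exprMn !enorm_sqr mulr_sumr.
by apply: eq_bigr => j _; rewrite mxE modulusM exprMn.
Qed.

Lemma modulus_eq0 (z : K) : (modulus z == 0) = (z == 0).
Proof.
apply/eqP/eqP => [|->]; last exact: modulus0.
by case: k z => z; [exact: normr0_eq0|exact: ComplexField.Normc.eq0_normc].
Qed.

Lemma enorm0 p : enorm (0 : 'cV[K]_p) = 0.
Proof. by rewrite -(scale0r (0 : 'cV[K]_p)) enormZ modulus0 mul0r. Qed.

Lemma enorm_eq0 p (x : 'cV[K]_p) : (enorm x == 0) = (x == 0).
Proof.
apply/eqP/eqP => [x0|->]; last exact: enorm0.
apply/colP => j; rewrite mxE; apply/eqP.
by rewrite -modulus_eq0 eq_le modulus_ge0 -x0 le_modulus_enorm.
Qed.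

Lemma enorm_gt0 p (x : 'cV[K]_p) : (0 < enorm x) = (x != 0).
Proof. by rewrite lt_def enorm_eq0 enorm_ge0 andbT. Qed.

Lemma sparseZ p (c : K) s (x : 'cV[K]_p) : sparse s x -> sparse s (c *: x).
Proof.
apply: leq_trans; apply: subset_leq_card; apply/fintype.subsetP => j.
by rewrite !inE mxE mulf_eq0 negb_or => /andP[].
Qed.

Lemma enorm_sqr_delta p (i : 'I_p) : enorm (delta_mx i 0 : 'cV[K]_p) ^+ 2 = 1.
Proof.
rewrite enorm_sqr (bigD1 i)//= mxE !eqxx big1 => [|j /negPf ji].
  by rewrite modulus_sqr rmorph1 mulr1 addr0; case: k.
by rewrite mxE ji modulus0 expr0n.
Qed.

End Inner.

(** * Columns and Gram matrix of a matrix with the RIP *)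

Section Rip.
Context (R : realType) (k : scalar_kind) (q p : nat).
Local Notation K := (scalar_field R k).
Context (C : 'M[K]_(q, p)).

Lemma rip_le s s' d : (s <= s')%N -> rip C s' d -> rip C s d.
Proof.
by move=> ss' [d0 Cd]; split=> // x xs; apply: Cd; exact: leq_trans xs ss'.
Qed.

Lemma rip_const_le s s' : (s <= s')%N -> rip_const C s <= rip_const C s'.
Proof.
move=> ss'; apply: (rip_const_min C s).2.
exact: rip_le ss' (rip_const_min C s').1.
Qed.

(** A column is the image of a standard basis vector, which is 1-sparse of norm 1. *)
Lemma rip_col s d i : (0 < s)%N -> rip C s d ->
  1 - d <= enorm (col i C) ^+ 2 <= 1 + d.
Proof.
move=> s0 [_ /(_ (delta_mx i 0))].
rewrite enorm_sqr_delta !mulr1 -colE; apply.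
apply: (@leq_trans #|[set i]%SET|); last by rewrite cards1.
apply: subset_leq_card.
apply/fintype.subsetP => j; rewrite !inE mxE.
by case: (j == i) => /=; rewrite ?eqxx.
Qed.

(* Apply the RIP to [e_i + t y] and [e_i - t y], where [y] is supported on [T]
   with [y_j = sconj <a_i, a_j>], and choose [t] optimally. *)
Lemma rip_gram_row s d i (T : {set 'I_p}) : (#|T| < s)%N -> i \notin T ->
  rip C s d -> \sum_(j in T) modulus (inner (col i C) (col j C)) ^+ 2 <= d ^+ 2.
Proof.
move=> Ts iT [d0 Cd]; set Q := \sum_(j in T) _.
pose y : 'cV[K]_p :=
  \col_j if j \in T then sconj (inner (col i C) (col j C)) else 0.
have Q0 : 0 <= Q by apply: sumr_ge0 => j _; exact: sqr_ge0.
have yQ : enorm y ^+ 2 = Q.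
  rewrite enorm_sqr /Q [RHS]big_mkcond/=; apply: eq_bigr => j _.
  by rewrite mxE; case: ifP => _; rewrite ?modulus_sconj// modulus0 expr0n.
have CyQ : real_part (inner (col i C) (C *m y)) = Q.
  have -> : C *m y = \sum_j y j 0 *: col j C.
    apply/colP => l; rewrite mxE summxE; apply: eq_bigr => j _.
    by rewrite !mxE mulrC.
  rewrite inner_sumr raddf_sum /Q [RHS]big_mkcond/=; apply: eq_bigr => j _.
  rewrite innerZr mxE; case: ifP => _; last by rewrite mul0r raddf0.
  by rewrite modulus_sqr.
have diy : inner (delta_mx i 0) y = 0.
  rewrite /inner big1// => j _; rewrite !mxE; case: (eqVneq j i) => [->|ji].
    by rewrite (negPf iT) mulr0.
  by rewrite rmorph0 mul0r.
have Ct (t : R) : (1 - d) * (1 + t ^+ 2 * Q) <=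
    enorm (col i C) ^+ 2 + t * Q *+ 2 + t ^+ 2 * enorm (C *m y) ^+ 2
    <= (1 + d) * (1 + t ^+ 2 * Q).
  have := Cd (delta_mx i 0 + real_scalar k t *: y).
  rewrite mulmxDr -colE -scalemxAr !enorm_sqrD enorm_sqr_delta diy raddf0 CyQ.
  rewrite yQ mulr0 mul0rn addr0; apply.
  (* The support lies in [T] together with [i], which is why [T] must have strictly fewer than [s]
     elements. *)
  apply: (@leq_trans #|i |: T|); last by rewrite cardsU1 iT.
  apply: subset_leq_card; apply/fintype.subsetP => j; rewrite !inE !mxE.
  by case: (j == i); case: (j \in T); rewrite /= ?mulr0 ?addr0 ?eqxx.
(* Subtracting the lower bound at [- t] from the upper bound at [t] cancels both squared norms and
   leaves twice the cross term. *)
have {}Ct (t : R) : t * Q *+ 2 <= d * (1 + t ^+ 2 * Q).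
  have /andP[_ tQ] := Ct t; have /andP[+ _] := Ct (- t).
  by rewrite sqrrN; lra.
have [->|Qn0] := eqVneq Q 0; first exact: sqr_ge0.
have r0 : 0 < Num.sqrt Q by rewrite sqrtr_gt0 lt_def Qn0.
move: r0 (sqr_sqrtr Q0); move: (Num.sqrt Q) => r r0 Qr.
rewrite -Qr lerXn2r ?nnegrE ?(ltW r0)//.
(* The value [t = 1 / sqrt Q] minimises [(1 + t^2 Q) / t] and yields [2 sqrt Q <= 2 d]. *)
have := Ct r^-1; rewrite -Qr exprVn mulVf ?expf_neq0 ?gt_eqF//.
by rewrite expr2 mulrA mulVf ?gt_eqF// mul1r; lra.
Qed.

End Rip.

(** * Two inequalities for finite sums *)

(** The nonnegative sum of the squares of [H g_i - S h_i] equals [H (G H - S^2)]. Divide by [H]; if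
    [H = 0], every [h_i] vanishes. *)
Lemma cauchy_schwarz_sum (R : realFieldType) (I : finType) (P : pred I)
    (g h : I -> R) :
  (\sum_(i | P i) g i * h i) ^+ 2 <=
  (\sum_(i | P i) g i ^+ 2) * (\sum_(i | P i) h i ^+ 2).
Proof.
set H := \sum_(i | P i) h i ^+ 2; set S := \sum_(i | P i) g i * h i.
set G := \sum_(i | P i) g i ^+ 2.
have H0 : 0 <= H by apply: sumr_ge0 => i _; exact: sqr_ge0.
have : 0 <= \sum_(i | P i) (H * g i - S * h i) ^+ 2.
  by apply: sumr_ge0 => i _; exact: sqr_ge0.
have -> : \sum_(i | P i) (H * g i - S * h i) ^+ 2 = H * (G * H - S ^+ 2).
  rewrite (eq_bigr (fun i => H ^+ 2 * g i ^+ 2 + - (2 * H * S) * (g i * h i)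
    + S ^+ 2 * h i ^+ 2)) => [|i _]; last by ring.
  by rewrite !big_split/= -!mulr_sumr -/H -/S -/G; ring.
have [H_eq0 _|Hn0] := eqVneq H 0.
  rewrite /S big1 ?expr0n ?H_eq0 ?mulr0// => i Pi.
  have /eqP := H_eq0; rewrite psumr_eq0; last by move=> j _; exact: sqr_ge0.
  by move=> /allP/(_ i (mem_index_enum _)); rewrite Pi/= sqrf_eq0 => /eqP->;
     rewrite mulr0.
by rewrite pmulr_rge0 ?subr_ge0// lt_def Hn0.
Qed.

(** Induction on [l]: split off the first [s] elements of [T]; the remainder inherits the hypothesis
    on small subsets. *)
Lemma ler_sum_blocks (R : numDomainType) (I : finType) (f : I -> R) (c : R)
    (s l : nat) (T : {set I}) :
  (forall U : {set I}, U \subset T -> (#|U| <= s)%N -> \sum_(i in U) f i <= c) ->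
  (#|T| <= l * s)%N -> \sum_(i in T) f i <= l%:R * c.
Proof.
elim: l T => [|l IHl] T fc Tls.
  move: Tls; rewrite mul0n leqn0 cards_eq0 => /eqP->.
  by rewrite big_set0 mul0r.
pose U := [set i in take s (enum T)]%SET.
have UT : U \subset T.
  by apply/fintype.subsetP => i; rewrite inE => /mem_take; rewrite mem_enum.
have cU : #|U| = minn s #|T|.
  rewrite cardsE (card_uniqP _) ?take_uniq ?enum_uniq//.
  by rewrite size_take_min -cardE.
rewrite (big_setID U)/= (finset.setIidPr UT) -natr1 mulrDl mul1r addrC lerD//.
  apply: IHl => [V VT|].
    by apply: fc; apply: fintype.subset_trans VT (finset.subsetDl _ _).
  by rewrite cardsDS// cU; move: Tls; rewrite mulSn; lia.
by apply: fc; rewrite // cU geq_minl.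
Qed.

(** * Off-diagonal and diagonal parts of the hierarchical operator *)

Section Hierarchical.
Context (R : realType) (k : scalar_kind) (M m N : nat) (n : 'I_N -> nat).
Local Notation K := (scalar_field R k).
Context (sigma : 'I_N -> nat) (B : forall i : 'I_N, 'M[K]_(m, n i)).
Context (A : 'M[K]_(M, N)).

Lemma block_sparse_sparse (s : nat) (x : block_vector R k n) :
  block_sparse s sigma x -> forall i, sparse (sigma i) (x i).
Proof.
move=> [_ xs] i; have [xi0|/xs//] := eqVneq (x i) 0.
rewrite /sparse (_ : supp _ = finset.set0) ?cards0//.
by apply/setP => j; rewrite !inE xi0 mxE eqxx.
Qed.

(** Both sides are homogeneous in [u] and [v], so nonzero vectors can be normalised without changing
    their supports. *)
Lemma incoherent_inner_le (delta : R) i j (u : 'cV[K]_(n i)) (v : 'cV[K]_(n j)) :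
  pairwise_incoherent B delta sigma -> i != j ->
  sparse (sigma i) u -> sparse (sigma j) v ->
  modulus (inner (B i *m u) (B j *m v)) <= delta * (enorm u * enorm v).
Proof.
move=> incB ij us vs.
have [->|u0] := eqVneq u 0;
  first by rewrite mulmx0 inner0l modulus0 enorm0 !(mul0r, mulr0).
have [->|v0] := eqVneq v 0;
  first by rewrite mulmx0 inner0r modulus0 enorm0 !mulr0.
pose cu := real_scalar k (enorm u)^-1; pose cv := real_scalar k (enorm v)^-1.
have mcu : modulus cu = (enorm u)^-1.
  by rewrite modulus_real_scalar ger0_norm// invr_ge0 enorm_ge0.
have mcv : modulus cv = (enorm v)^-1.
  by rewrite modulus_real_scalar ger0_norm// invr_ge0 enorm_ge0.
have := incB i j ij (cu *: u) (cv *: v).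
rewrite !enormZ mcu mcv !mulVf ?enorm_eq0// -!scalemxAr innerZl innerZr.
rewrite !modulusM modulus_sconj mcu mcv => /(_ erefl erefl).
move=> /(_ (sparseZ _ us) (sparseZ _ vs)).
rewrite mulrA -invfM ler_pdivrMl ?mulr_gt0 ?enorm_gt0//.
by rewrite [leRHS]mulrC.
Qed.

(* Cauchy-Schwarz over the off-diagonal pairs of [S]: each row of the Gram
   matrix of [A] is cut into [l] pieces of size at most [s], and [rip_gram_row]
   bounds the mass of each piece. *)
Lemma gram_off_diagonal_le (s l : nat) (d : R) (S : {set 'I_N}) (t : 'I_N -> R) :
  (0 < s)%N -> rip A (2 * s) d -> (#|S| <= l * s)%N ->
  \sum_(i in S) \sum_(j in S :\ i)
    modulus (inner (col i A) (col j A)) * (t i * t j)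
  <= l%:R * Num.sqrt s%:R * d * \sum_i t i ^+ 2.
Proof.
move=> s0 Ad Sls; have [d0 _] := Ad; set T := \sum_i _.
have T0 : 0 <= T by apply: sumr_ge0 => i _; exact: sqr_ge0.
rewrite pair_big_dep/=; set P := \sum_(p | _) _.
(* Squaring both sides requires [P] to be nonnegative; otherwise the claim is immediate. *)
have [|P0] := leP P 0.
  by move=> /le_trans; apply; rewrite !mulr_ge0 ?sqrtr_ge0.
rewrite -(@ler_pXn2r R 2) ?nnegrE ?(ltW P0) ?mulr_ge0 ?sqrtr_ge0//.
apply: (le_trans (cauchy_schwarz_sum _
  (fun p : 'I_N * 'I_N => modulus (inner (col p.1 A) (col p.2 A)))
  (fun p => t p.1 * t p.2))).
rewrite [leRHS]exprMn.
(* The Gram factor is to be bounded by [(l sqrt s d)^2], the factor with the [t i] by [T^2]. *)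
apply: ler_pM; [by apply: sumr_ge0 => ? _; exact: sqr_ge0 ..| |].
  rewrite -(pair_big_dep (mem S) (fun i j => j \in S :\ i)
    (fun i j => modulus (inner (col i A) (col j A)) ^+ 2))/=.
  apply: (@le_trans _ _ (\sum_(i in S) l%:R * d ^+ 2)).
    apply: ler_sum => i iS; apply: (@ler_sum_blocks _ _ _ _ s) => [U US Us|].
      (* Since [s > 0], a piece of size at most [s] has fewer than [2 * s] elements. *)
      apply: (rip_gram_row _ _ Ad); first by apply: leq_ltn_trans Us _; lia.
      by apply: contraTN iS => /(fintype.subsetP US); rewrite !inE eqxx.
    by apply: leq_trans Sls; rewrite subset_leq_card ?subD1set.
  (* At most [l * s] rows, each of mass at most [l d^2], give [l^2 s d^2]. *)
  rewrite sumr_const -[leLHS]mulr_natl !exprMn sqr_sqrtr ?ler0n//.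
  rewrite (_ : _ * s%:R * _ = (l * s)%:R * (l%:R * d ^+ 2)).
    by rewrite ler_wpM2r ?ler_nat// mulr_ge0// sqr_ge0.
  by rewrite natrM; ring.
(* Dropping the restrictions on [i] and [j] only adds nonnegative terms and leaves [T * T]. *)
rewrite -(pair_big_dep (mem S) (fun i j => j \in S :\ i)
    (fun i j => (t i * t j) ^+ 2))/=.
rewrite expr2 {1}/T mulr_suml big_mkcond/=; apply: ler_sum => i _.
case: ifP => _; last by rewrite mulr_ge0// sqr_ge0.
rewrite mulr_sumr big_mkcond/=; apply: ler_sum => j _.
by case: ifP => _; rewrite ?exprMn// mulr_ge0// sqr_ge0.
Qed.

(** Each inner product factors over the Kronecker product. Incoherence bounds the second factor,
    leaving the Gram form of [A] at the block norms, supported on [block_supp x]. *)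
Lemma hierarchical_off_diagonal_le (delta d : R) (s l : nat)
    (x : block_vector R k n) :
  (0 < s)%N -> 0 <= delta -> pairwise_incoherent B delta sigma ->
  rip A (2 * s) d -> block_sparse (l * s) sigma x ->
  `|\sum_i \sum_(j | j != i)
    real_part (@inner R k (M * m) (col i A *t (B i *m x i))
                                      (col j A *t (B j *m x j)))|
  <= l%:R * Num.sqrt s%:R * d * delta * block_enorm x ^+ 2.
Proof.
move=> s0 delta0 incB Ad xls.
have xs := block_sparse_sparse xls; have {xls} [xls _] := xls.
have supp0 i : i \notin block_supp x -> enorm (x i) = 0.
  by rewrite inE negbK => /eqP->; apply/eqP; rewrite enorm_eq0.
have := gram_off_diagonal_le (fun i => enorm (x i)) s0 Ad xls.
rewrite -block_enorm_sqr => /(ler_wpM2l delta0) gram.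
rewrite -mulrA (mulrCA _ delta); apply: le_trans gram.
apply: (le_trans (ler_norm_sum _ _ _)); rewrite mulr_sumr [leRHS]big_mkcond/=.
apply: ler_sum => i _; apply: (le_trans (ler_norm_sum _ _ _)).
have xij j : j != i -> `|real_part (@inner R k (M * m)
    (col i A *t (B i *m x i)) (col j A *t (B j *m x j)))| <=
    delta * (modulus (inner (col i A) (col j A)) * (enorm (x i) * enorm (x j))).
  move=> ji; apply: (le_trans (real_part_le_modulus _)).
  rewrite inner_tens modulusM mulrCA ler_wpM2l ?modulus_ge0//.
  by apply: incoherent_inner_le; rewrite // eq_sym.
case: ifPn => [iS|/supp0 xi0]; last first.
  rewrite big1// => j ji; apply/eqP; rewrite -normr_le0.
  by rewrite normr_id; apply: le_trans (xij j ji) _; rewrite xi0 mul0r !mulr0.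
rewrite mulr_sumr [leLHS]big_mkcond [leRHS]big_mkcond/=; apply: ler_sum => j _.
rewrite in_setD1; case: ifPn => //= ji; apply: le_trans (xij j ji) _.
by case: ifPn => // /supp0->; rewrite !mulr0.
Qed.

(** Each term is a squared column norm times a squared block image norm, so the bounds multiply. The
    upper product is exact; the lower one, [(1 - d) (1 - delta)], exceeds the claim by
    [2 d delta]. *)
Lemma hierarchical_diagonal_bounds (s : nat) (d delta : R)
    (x : block_vector R k n) :
  (0 < s)%N -> d <= 1 -> rip A s d -> 0 <= delta ->
  (forall i, rip (B i) (sigma i) delta) ->
  (forall i, sparse (sigma i) (x i)) ->
  (1 - (d + delta + d * delta)) * block_enorm x ^+ 2 <=
  \sum_i @enorm R k (M * m) (col i A *t (B i *m x i)) ^+ 2 <=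
  (1 + (d + delta + d * delta)) * block_enorm x ^+ 2.
Proof.
move=> s0 d1 Ad delta0 Bd xs; have [d0 _] := Ad.
rewrite block_enorm_sqr !mulr_sumr; apply/andP; split; apply: ler_sum => i _;
  rewrite enorm_sqr_tens; have /andP[a1 a2] := rip_col i s0 Ad;
  have /andP[b1 b2] := (Bd i).2 _ (xs i).
- apply: (@le_trans _ _ ((1 - d) * ((1 - delta) * enorm (x i) ^+ 2))).
    rewrite mulrA ler_wpM2r ?sqr_ge0//.
    have := mulr_ge0 d0 delta0; lra.
  (* As [1 - delta] may be negative, the two factors are replaced one at a time, using only
     [0 <= 1 - d]. *)
  apply: (@le_trans _ _ ((1 - d) * enorm (B i *m x i) ^+ 2)).
    by rewrite ler_wpM2l// subr_ge0.
  by rewrite ler_wpM2r// sqr_ge0.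
- rewrite (_ : (1 + _) = (1 + d) * (1 + delta)); last by ring.
  by rewrite -mulrA ler_pM// sqr_ge0.
Qed.

End Hierarchical.

(** * The HiRIP bound *)

Theorem theorem3p2 (R : realType) (k : scalar_kind) (M m N : nat)
    (n : 'I_N -> nat) (sigma : 'I_N -> nat)
    (B : forall i : 'I_N, 'M[scalar_field R k]_(m, n i))
    (A : 'M[scalar_field R k]_(M, N))
    (delta_2sigma delta_sigma : R) (s : nat)
    (hsigma : forall i : 'I_N, (0 < sigma i)%N)
    (hdelta_2sigma : 0 < delta_2sigma)
    (hincoh : pairwise_incoherent B delta_2sigma sigma)
    (hB : sup (range (fun i : 'I_N => rip_const (B i) (sigma i)))
          <= delta_sigma)
    (hs : (0 < s)%N)
    (hA : rip_const A (2 * s) < 1)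
    (lambda : nat) (hlambda : (0 < lambda)%N) :
  hirip_const (hierarchical_operator A B) (lambda * s) sigma
  <= rip_const A s + delta_sigma + rip_const A s * delta_sigma
     + lambda%:R * Num.sqrt s%:R * rip_const A (2 * s) * delta_2sigma.
Proof.
have [A1 _] := rip_const_min A s; have [A2 _] := rip_const_min A (2 * s).
have [d0 _] := A1; have [d20 _] := A2.
have d1 : rip_const A s <= 1.
  by apply: le_trans (ltW hA); apply: rip_const_le; lia.
have B0 i : 0 <= rip_const (B i) (sigma i) := (rip_const_min _ _).1.1.
have Bdelta i : rip_const (B i) (sigma i) <= delta_sigma.
  apply: le_trans hB; apply: ub_le_sup; last by exists i.
  (* [sup] dominates the family only once it is known to be bounded; a sum of nonnegative constants
     bounds each of them. *)
  exists (\sum_j rip_const (B j) (sigma j)) => _ [j _ <-].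
  by rewrite (bigD1 j)//= lerDl sumr_ge0.
have delta0 : 0 <= delta_sigma.
  case: (pickP 'I_N) => [i _|N0]; first exact: le_trans (B0 i) (Bdelta i).
  (* Without any block the supremum is that of the empty set, which is 0 by convention. *)
  move: hB; rewrite (_ : range (fun i : 'I_N => _) = classical_sets.set0) ?sup0//.
  by apply/seteqP; split=> // _ [i _ <-]; have := N0 i.
have Brip i : rip (B i) (sigma i) delta_sigma.
  split=> // x xs.
  have [_ /(_ x xs)/andP[b1 b2]] := (rip_const_min (B i) (sigma i)).1.
  apply/andP; split; [apply: le_trans b1|apply: le_trans b2 _];
    by rewrite ler_wpM2r ?sqr_ge0// ?lerD2l ?lerN2.
(* By minimality it suffices that the right-hand side is an admissible HiRIP constant. *)
apply: (hirip_const_min A B _ sigma).2; split.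
  by rewrite !addr_ge0// ?mulr_ge0 ?sqrtr_ge0// ltW.
move=> x xs.
have := hierarchical_off_diagonal_le hs (ltW hdelta_2sigma) hincoh A2 xs.
rewrite ler_norml => /andP[o1 o2].
have xsi := block_sparse_sparse xs.
have /andP[g1 g2] := hierarchical_diagonal_bounds hs d1 A1 delta0 Brip xsi.
rewrite /hierarchical_operator enorm_sqr_sum.
apply/andP; split.
  by rewrite opprD addrA mulrDl lerD// [leLHS]mulNr.
by rewrite addrA [leRHS]mulrDl lerD.
Qed.
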